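(* Let $k\ge1$ and let $K$ be a finite pure $k$-dimensional simplicial complex whose vertex set $[n]=\{1,\dots,n\}$ is labeled so that $\deg_K(1)\ge\deg_K(2)\ge\cdots\ge\deg_K(n)$. Let $K_k\subseteq\binom{[n]}{k+1}$ be its family of facets. Then there is a shifted $(k+1)$-uniform family $\mathcal{H}\subseteq\binom{[n]}{k+1}$ with $|\mathcal{H}|=|K_k|$ and $$\tfrac12\bigl|K_k\,\triangle\,\mathcal{H}\bigr|\ \le\ \tfrac12\left[\sum_{r\ge1}\bigl(d^{\mathrm{v},\mathsf{T}}_{r}(K)\bigr)^{2}-\sum_{r}\lambda_r(K)^{2}\right].$$
   Context: $\binom{[n]}{s}$ is the set of $s$-element subsets of $[n]$; $\triangle$ is symmetric difference. A simplicial complex is pure $k$-dimensional if all its facets (inclusion-maximal faces) have exactly $k+1$ vertices; $K_k$ denotes the set of facets. $\deg_K(v)$ is the number of facets of $K$ containing the vertex $v$, and $d^{\mathrm{v},\mathsf{T}}_{r}(K)$ is the number of vertices $v\in[n]$ with $\deg_K(v)\ge r$ (the conjugate vertex-degree partition). $\lambda_1(K)\ge\lambda_2(K)\ge\cdots>0$ are the nonzero eigenvalues, listed with multiplicity, of the $(k-1)$-dimensional up-Laplacian $L^{\mathrm{up}}_{k-1}(K)=\partial_k\partial_k^{\mathsf{T}}$, where $\partial_k$ is the matrix of the standard (unweighted, oriented) simplicial boundary map from real $k$-chains to real $(k-1)$-chains of $K$ with respect to the bases of oriented faces. The sum $\sum_r\lambda_r(K)^2$ is over all these nonzero eigenvalues.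 A family $\mathcal{H}\subseteq\binom{[n]}{s}$ is *shifted* if $(F\setminus\{j\})\cup\{i\}\in\mathcal{H}$ whenever $F\in\mathcal{H}$, $i<j$, $j\in F$ and $i\notin F$. The family $\mathcal{H}$ need not use every label of $[n]$. *)

(* Defs.v *)
From mathcomp Require Import all_boot all_order all_algebra.
From mathcomp Require Import polyrcf.

Set Implicit Arguments.
Unset Strict Implicit.
Unset Printing Implicit Defensive.

Import Order.TTheory GRing.Theory Num.Theory.
Local Open Scope ring_scope.

(* The vertex i of [n] = {1, ..., n} is represented by the ordinal of value
   i - 1.  A complex is the set of its faces, the empty face included; the
   singleton condition says that every label is a vertex. *)
Definition simplicial_complex (n : nat) (K : {set {set 'I_n}}) : Prop :=
  (forall v : 'I_n, [set v] \in K) /\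
  (forall F G : {set 'I_n}, F \in K -> G \subset F -> G \in K).

Definition facets (n : nat) (K : {set {set 'I_n}}) : {set {set 'I_n}} :=
  [set F | maxset [pred G | G \in K] F].

Definition uniform (n s : nat) (H : {set {set 'I_n}}) : Prop :=
  forall F : {set 'I_n}, F \in H -> #|F| = s.

Definition pure (n k : nat) (K : {set {set 'I_n}}) : Prop :=
  uniform k.+1 (facets K).

Definition vdeg (n : nat) (K : {set {set 'I_n}}) (v : 'I_n) : nat :=
  #|[set F in facets K | v \in F]|.

Definition conj_vdeg (n : nat) (K : {set {set 'I_n}}) (r : nat) : nat :=
  #|[set v : 'I_n | (r <= vdeg K v)%N]|.

Definition shifted (n : nat) (H : {set {set 'I_n}}) : Prop :=
  forall (F : {set 'I_n}) (i j : 'I_n),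
    F \in H -> (i < j)%N -> j \in F -> i \notin F -> i |: (F :\ j) \in H.

Definition symdiff (T : finType) (A B : {set T}) : {set T} :=
  (A :\: B) :|: (B :\: A).

(* Faces are indexed by cardinality: faces K s is the set of faces of
   dimension s - 1. *)
Definition faces (n : nat) (K : {set {set 'I_n}}) (s : nat) :
  {set {set 'I_n}} := [set F in K | #|F| == s].

(* Faces are oriented by the order of the labels.  For v_0 < ... < v_k,
   boundary_coef [set v_0; ...; v_k] G is the coefficient of G in
   \sum_i (-1)^i [v_0, ..., v_(i-1), v_(i+1), ..., v_k];
   the index of a vertex v of F is the number of vertices of F below v. *)
Definition boundary_coef (R : rcfType) (n : nat) (F G : {set 'I_n}) : R :=
  \sum_(v in F | F :\ v == G) (-1) ^+ #|[set u in F | (u < v)%N]|.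

(* The map from k-chains to (k-1)-chains: columns are the k-dimensional faces
   (k + 1 vertices), rows the (k-1)-dimensional ones (k vertices). *)
Definition boundary_mx (R : rcfType) (n : nat) (K : {set {set 'I_n}})
    (k : nat) : 'M[R]_(#|faces K k|, #|faces K k.+1|) :=
  \matrix_(i, j) boundary_coef R (enum_val j) (enum_val i).

(* L^up_(k-1) = \partial_k \partial_k^T. *)
Definition up_laplacian (R : rcfType) (n : nat) (K : {set {set 'I_n}})
    (k : nat) : 'M[R]_#|faces K k| :=
  boundary_mx R K k *m (boundary_mx R K k)^T.

(* Decreasing list of the nonzero eigenvalues in R, each repeated according to
   its multiplicity as a root of the characteristic polynomial. *)
Definition nz_eigenvalues (R : rcfType) (m : nat) (A : 'M[R]_m) : seq R :=
  sort >=%O (flatten [seq nseq (mup a (char_poly A)) a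
                     | a <- rootsR (char_poly A) & a != 0]).

(* Main.v *)
(* Put A = K_k and s = k + 1, call two s-sets adjacent when they differ by
   exchanging one element, and let E(A) be the number of ordered adjacent pairs
   in A.  The trace of (L^up)^2 is that of (\partial^T \partial)^2, namely
   |A| s^2 + E(A), while the degree ordering turns \sum_r (d_r^T)^2 into
   \sum_(F in A) \sum_(v in F) (2v - 1) for labels v >= 1.  So the bound
   compares |A \ H| with the label weight of A less the number E(A)/2 of edges
   in A.
   An (i,j)-compression with i < j lowers the label weight by at least the
   number of sets it moves and, as (i j) acts on the adjacency graph by
   automorphisms, does not lower E.  Compress until the family H is shifted;
   the bound follows since E(H)/2 is at most the number of triples (F, i, j)
   with F in H, i < j, j in F and i not in F, which is the label weight of H
   less its least possible value |H| s(s+1)/2. *)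
Require Import Defs.
From mathcomp Require Import all_boot all_order all_algebra.
From mathcomp Require Import perm polyrcf complex.
From mathcomp Require Import zify.

Set Implicit Arguments.
Unset Strict Implicit.
Unset Printing Implicit Defensive.

Import Order.TTheory GRing.Theory Num.Theory.
Local Open Scope ring_scope.

(** * Eigenvalues of symmetric matrices over a real closed field *)

Lemma char_poly_conj (F : comUnitRingType) n (P A : 'M[F]_n) :
  P \in unitmx -> char_poly (invmx P *m A *m P) = char_poly A.
Proof.
move=> uP; rewrite /char_poly /char_poly_mx.
have -> : 'X%:M - map_mx polyC (invmx P *m A *m P) =
    map_mx polyC (invmx P) *m ('X%:M - map_mx polyC A) *m map_mx polyC P.
  rewrite mulmxBr mulmxBl !map_mxM -[_ *m _%:M *m _]mulmxA -scalar_mxC.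
  rewrite mulmxA -[map_mx _ _ *m map_mx _ P]map_mxM.
  by rewrite mulVmx // map_mx1 mul1mx.
by rewrite !det_mulmx mulrAC -det_mulmx -map_mxM mulVmx // map_mx1 det1 mul1r.
Qed.

(** Over [R[i]] the matrix is Hermitian, hence unitarily diagonalizable with real eigenvalues; both
    identities descend to [R] because the embedding is injective. *)
Lemma real_symmetric_spectrum (R : rcfType) n (A : 'M[R]_n) : A^T = A ->
  exists r : 'I_n -> R,
    char_poly A = \prod_i ('X - (r i)%:P) /\ \tr (A *m A) = \sum_i r i ^+ 2.
Proof.
move=> symA; pose toC := real_complex R.
pose B : 'M[R[i]]_n := map_mx toC A.
have Breal : B \is a realmx.
  by apply/mxOverP => i j; rewrite mxE; apply/complex_realP; exists (A i j).
have Bherm : B \is hermsymmx.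
  apply: realsym_hermsym Breal; apply/is_hermitianmxP.
  by rewrite expr0 scale1r map_mx_id // /B map_trmx symA.
have /orthomx_spectralP defB := hermitian_normalmx Bherm.
have Dreal := hermitian_spectral_diag_real Bherm.
set P := spectralmx B in defB; set D := spectral_diag B in defB Dreal.
have uP : P \in unitmx by apply: spectral_unit.
have defD i : D 0 i = toC (complex.Re (D 0 i)).
  by rewrite /toC RRe_real //; apply: (mxOverP Dreal).
exists (fun i => complex.Re (D 0 i)); split.
  apply: (map_poly_inj toC); rewrite map_char_poly -/B defB char_poly_conj //.
  rewrite char_poly_trig ?diag_mx_is_trig // rmorph_prod; apply: eq_bigr => i _.
  by rewrite rmorphB /= map_polyX map_polyC /= mxE eqxx mulr1n defD.
apply: (@complexI R).
transitivity (\tr (B *m B)); first by rewrite -map_mxM trace_map_mx.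
have -> : B *m B = invmx P *m (diag_mx D *m diag_mx D) *m P.
  by rewrite defB !mulmxA mulmxK.
rewrite mxtrace_mulC mulKVmx // mulmx_diag mxtrace_diag.
rewrite rmorph_sum; apply: eq_bigr => i _.
by rewrite mxE {1 2}defD expr2 rmorphM.
Qed.

(** A root's multiplicity [mup] is the number of times it occurs among the [r i], and the zero
    eigenvalues contribute nothing to the sum of squares. *)
Lemma sum_sqr_nz_eigenvalues (R : rcfType) n (A : 'M[R]_n) : A^T = A ->
  \sum_(l <- nz_eigenvalues A) l ^+ 2 = \tr (A *m A).
Proof.
move=> /real_symmetric_spectrum[r [defp ->]].
have p0 : char_poly A != 0 by rewrite monic_neq0 ?char_poly_monic.
rewrite /nz_eigenvalues (perm_big _ (permEl (perm_sort _ _))) /=.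
rewrite big_flatten big_map big_filter /=.
pose s := [seq r i | i <- index_enum 'I_n].
have muE a : mup a (char_poly A) = count_mem a s.
  by rewrite defp -(big_map r xpredT (fun x => 'X - x%:P)) mu_prod_XsubC.
transitivity (\sum_(a <- undup s | a != 0) a ^+ 2 *+ count_mem a s).
  have perm_roots : perm_eq (rootsR (char_poly A)) (undup s).
    apply: uniq_perm; rewrite ?undup_uniq ?uniq_roots // => a.
    rewrite -(roots_on_rootsR p0 a) /= mem_undup -has_pred1 has_count -muE.
    by rewrite -XsubC_dvd // dvdp_XsubCl.
  rewrite (perm_big _ perm_roots) /=; apply: eq_bigr => a _.
  by rewrite big_nseq -muE iter_addr_0.
rewrite -(big_map r xpredT (fun x => x ^+ 2)) -/s.
rewrite [RHS](bigID (fun a => a != 0)) /=.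
rewrite [X in _ = _ + X]big1 ?addr0; last first.
  by move=> a /negbNE/eqP->; rewrite expr0n.
by rewrite -[RHS]big_undup_iterop_count.
Qed.

Lemma card_setD_triangle (T : finType) (X Y Z : {set T}) :
  (#|X :\: Z| <= #|X :\: Y| + #|Y :\: Z|)%N.
Proof.
apply: leq_trans (leq_card_setU _ _); apply/subset_leq_card/subsetP => x.
by rewrite !inE; case: (x \in X) (x \in Y) (x \in Z) => [] [] [].
Qed.

(** * Compressions: their effect on weight and adjacency *)

Section Compression.
Local Open Scope nat_scope.
Variable n : nat.
Implicit Types (F G : {set 'I_n}) (A H : {set {set 'I_n}}).

(** On sets of a fixed size this is the edge relation of the Johnson graph. *)
Definition adj F G := (#|F :\: G| == 1) && (#|G :\: F| == 1).

Definition adj_pairs A := \sum_(F in A) \sum_(G in A) adj F G.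

(** Ordinals start at 0, so this is the sum of the labels in $[n]$ less the size of [F]. *)
Definition label_sum F := \sum_(v in F) v.

Definition weight A := \sum_(F in A) label_sum F.

Lemma adj_sym F G : adj F G = adj G F.
Proof. exact: andbC. Qed.

Lemma adj_irrefl F : adj F F = false.
Proof. by rewrite /adj setDv cards0. Qed.

Variables i j : 'I_n.
Hypothesis lt_ij : i < j.

Definition swap F := tperm i j @: F.

Lemma swapK : involutive swap.
Proof.
by move=> F; rewrite /swap -imset_comp (eq_imset _ (@tpermK _ i j)) imset_id.
Qed.

Lemma mem_swap F v : (v \in swap F) = (tperm i j v \in F).
Proof. by rewrite -{1}[v](tpermK i j) mem_imset //; apply: perm_inj. Qed.

Lemma card_swap F : #|swap F| = #|F|.
Proof. by rewrite card_imset //; apply: perm_inj. Qed.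

Lemma swapD F G : swap F :\: swap G = swap (F :\: G).
Proof. by apply/setP => v; rewrite !(inE, mem_swap). Qed.

Lemma adj_swap F G : adj (swap F) (swap G) = adj F G.
Proof. by rewrite /adj !swapD !card_swap. Qed.

Lemma adj_swapl F G : adj (swap F) G = adj F (swap G).
Proof. by rewrite -adj_swap swapK. Qed.

Definition upper F := (j \in F) && (i \notin F).

Lemma upper_swap F : upper (swap F) = (i \in F) && (j \notin F).
Proof. by rewrite /upper !mem_swap tpermR tpermL. Qed.

Lemma swap_upper F : upper F -> swap F = i |: (F :\ j).
Proof.
case/andP => jF iF; apply/setP => v; rewrite mem_swap !inE.
case: tpermP => [->|->|/eqP vi /eqP vj]; rewrite ?eqxx ?jF ?(negbTE iF) //.
  by rewrite orbF; apply/esym/negbTE; rewrite neq_ltn lt_ij orbT.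
by rewrite (negbTE vi) vj.
Qed.

Lemma swap_fixed F : ~~ upper F -> ~~ upper (swap F) -> swap F = F.
Proof.
rewrite upper_swap /upper !negb_and !negbK => h1 h2.
apply/setP => v; rewrite mem_swap.
case: tpermP => [->|->|//]; first by case: (j \in F) (i \in F) h1 h2 => [] [].
by case: (j \in F) (i \in F) h1 h2 => [] [].
Qed.

(** [swap F] contains [i] but not [j], and [G] the reverse. Adjacency leaves no other difference, so
    [G] is [swap F] with [i] exchanged back for [j]. *)
Lemma adj_upper_swap F G :
  upper F -> upper G -> adj (swap F) G -> F = G.
Proof.
move=> /[dup] uF /andP[jF iF] /andP[jG iG].
case/andP => /cards1P[x defx] /cards1P[y defy].
have ix : i \in swap F :\: G by rewrite inE iG mem_swap tpermL.
have jy : j \in G :\: swap F by rewrite inE jG mem_swap tpermR iF.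
move: ix jy; rewrite defx defy !inE => /eqP ix /eqP jy; subst x y.
apply/setP => v; have [->|vi] := eqVneq v i.
  by rewrite (negbTE iF) (negbTE iG).
have [->|vj] := eqVneq v j; first by rewrite jF jG.
have /setP/(_ v) := defx; have /setP/(_ v) := defy.
rewrite swap_upper // !inE (negbTE vi) (negbTE vj) /=.
by case: (v \in F) (v \in G) => [] [].
Qed.

(** In each two-element [swap]-orbit the number of members is kept and the set that is not [upper]
    is filled first. This is the usual shift, written so that orbits can be compared pointwise. *)
Definition compress A :=
  [set F | if upper F then (F \in A) && (swap F \in A)
           else if upper (swap F) then (F \in A) || (swap F \in A)
           else F \in A].

(** Reduces a claim about sums over all sets to one about a single orbit. *)
Lemma sum_swap (f : {set 'I_n} -> nat) :
  2 * \sum_F f F = \sum_F (f F + f (swap F)).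
Proof.
rewrite big_split /= mul2n -addnn; congr (_ + _).
exact/reindex_inj/can_inj/swapK.
Qed.

Lemma upper_swapF F : upper F -> upper (swap F) = false.
Proof. by rewrite upper_swap => /andP[-> /negbTE->]. Qed.

Lemma card_compress A : #|compress A| = #|A|.
Proof.
suff: 2 * #|compress A| = 2 * #|A| by lia.
rewrite -!sum1_card !(big_mkcond (fun F => F \in _)) /= !sum_swap.
apply: eq_bigr => F _; rewrite !inE swapK.
case uF: (upper F).
  by rewrite upper_swapF //; case: (F \in A) (swap F \in A) => [] [].
case uG: (upper (swap F)); first by case: (F \in A) (swap F \in A) => [] [].
by rewrite swap_fixed ?uF ?uG.
Qed.

Lemma uniform_compress s A : uniform s A -> uniform s (compress A).
Proof.
move=> sA F; rewrite inE; have [FA _|nFA] := boolP (F \in A); first exact: sA.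
have [GA _|nGA] := boolP (swap F \in A); first by rewrite -card_swap; apply: sA.
by case: ifP => // _; case: ifP.
Qed.

Lemma label_sum_swap F : upper F -> label_sum (swap F) < label_sum F.
Proof.
move=> uF; have /andP[jF iF] := uF.
rewrite /label_sum swap_upper // (big_setD1 j jF) big_setU1 /=.
  by rewrite ltn_add2r.
by rewrite !inE (negbTE iF) andbF.
Qed.

(** An orbit changes only if [A] holds its upper set alone; then one set leaves [A] and the label
    sum drops by at least 1. *)
Lemma weight_compress A : weight (compress A) + #|A :\: compress A| <= weight A.
Proof.
suff: 2 * (weight (compress A) + #|A :\: compress A|) <= 2 * weight A by lia.
rewrite /weight -!sum1_card !(big_mkcond (fun F => F \in _)) /= mulnDr.
rewrite !sum_swap -big_split; apply: leq_sum => F _; rewrite !inE swapK.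
case uF: (upper F).
  rewrite upper_swapF //; have := label_sum_swap uF.
  by case: (F \in A) (swap F \in A) => [] []; rewrite /=; lia.
case uG: (upper (swap F)).
  have := label_sum_swap uG; rewrite swapK.
  by case: (F \in A) (swap F \in A) => [] []; rewrite /=; lia.
have fF : swap F = F by apply: swap_fixed; rewrite ?uF ?uG.
by rewrite fF; case: (F \in A) => /=; lia.
Qed.

Lemma adj_pairsE A :
  adj_pairs A = \sum_F \sum_G (F \in A) * (G \in A) * adj F G.
Proof.
rewrite /adj_pairs big_mkcond; apply: eq_bigr => F _.
case: (F \in A); last by rewrite big1.
by rewrite big_mkcond; apply: eq_bigr => G _; case: (G \in A); rewrite ?mul1n.
Qed.

(* Averaging over the four images of (F, G) under [swap] in either coordinate
   makes the comparison pointwise.  Two orbits {F, swap F}, {G, swap G} carry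
   only parallel edges: a crossing one would force F = G, by
   [adj_upper_swap]. *)
Lemma adj_pairs_compress A : adj_pairs A <= adj_pairs (compress A).
Proof.
rewrite !adj_pairsE -(leq_pmul2l (isT : 0 < 4)).
have avg (f : {set 'I_n} -> {set 'I_n} -> nat) : 4 * \sum_F \sum_G f F G =
    \sum_F \sum_G (f F G + f F (swap G) + (f (swap F) G + f (swap F) (swap G))).
  rewrite -[4]/(2 * 2) -mulnA sum_swap big_distrr /=; apply: eq_bigr => F _.
  by rewrite mulnDr !sum_swap -big_split.
rewrite !avg; apply: leq_sum => F _; apply: leq_sum => G _.
pose S (B : {set {set 'I_n}}) F G := (F \in B) * (G \in B) * adj F G
  + (F \in B) * (swap G \in B) * adj F (swap G)
  + ((swap F \in B) * (G \in B) * adj (swap F) G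
  + (swap F \in B) * (swap G \in B) * adj (swap F) (swap G)).
change (S A F G <= S (compress A) F G).
have swapS B F0 G0 : S B (swap F0) G0 = S B F0 G0 by rewrite /S swapK; lia.
have symS B F0 G0 : S B F0 G0 = S B G0 F0.
  by rewrite /S !(adj_sym G0) !(adj_sym (swap G0)); lia.
(* A fixed [F0] is adjacent to both members of the orbit of [G0] or to neither, so only the number
   of members present matters, and compression keeps it. *)
have fixedS F0 G0 : swap F0 = F0 -> S A F0 G0 <= S (compress A) F0 G0.
  move=> fF; have uF0 : upper F0 = false.
    by apply/negP => /[dup] /upper_swapF; rewrite fF => ->.
  have adjF : adj F0 (swap G0) = adj F0 G0 by rewrite -adj_swapl fF.
  rewrite /S !fF !adjF !inE !swapK !fF uF0.
  case uG: (upper G0); [rewrite (upper_swapF uG)|case uG': (upper (swap G0))].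
  - by case: (adj _ _) (F0 \in A) (G0 \in A) (swap G0 \in A) => [] [] [] [].
  - by case: (adj _ _) (F0 \in A) (G0 \in A) (swap G0 \in A) => [] [] [] [].
  - by have -> : swap G0 = G0 by apply: swap_fixed; rewrite ?uG ?uG'.
(* For distinct orbits with a and b members present, at most min(a, b) parallel edges occur; filling
   lower sets first attains this whenever the orbits are joined. *)
have upperS F0 G0 : upper F0 -> upper G0 -> S A F0 G0 <= S (compress A) F0 G0.
  move=> uF uG; rewrite /S adj_swap !(adj_swapl F0 G0) !inE !swapK.
  rewrite uF uG !upper_swapF //.
  have [<-|nFG] := eqVneq F0 G0.
    rewrite adj_irrefl.
    by case: (adj _ _) (F0 \in A) (swap F0 \in A) => [] [] [].
  have /negbTE-> : ~~ adj F0 (swap G0).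
    by rewrite -adj_swapl; apply: contra nFG => /adj_upper_swap->.
  by case: (adj _ _) (F0 \in A) (swap F0 \in A) (G0 \in A) (swap G0 \in A) =>
     [] [] [] [] [].
have [fF|nF] := eqVneq (swap F) F; first exact: fixedS.
have [fG|nG] := eqVneq (swap G) G; first by rewrite !(symS _ F); apply: fixedS.
have orbit_upper F0 : swap F0 != F0 ->
    exists2 F1, upper F1 & F0 = F1 \/ F0 = swap F1.
  case uF: (upper F0); first by exists F0; auto.
  case uF': (upper (swap F0)); first by exists (swap F0); rewrite ?swapK; auto.
  by rewrite swap_fixed ?uF ?uF' ?eqxx.
have [F1 uF defF] := orbit_upper F nF; have [G1 uG defG] := orbit_upper G nG.
have SE B : S B F G = S B F1 G1.
  case: defF defG => -> [] ->; rewrite ?swapS //.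
    by rewrite symS swapS symS.
  by rewrite symS swapS symS.
rewrite !SE; exact: upperS.
Qed.


End Compression.

(** * Existence of the shifted family and the edge bound *)

Section Shifting.
Local Open Scope nat_scope.
Variable n : nat.
Implicit Types (F G : {set 'I_n}) (A H : {set {set 'I_n}}).

Lemma shifted_or_compressible A :
  shifted A \/
  exists i j : 'I_n, i < j /\ 0 < #|A :\: compress i j A|.
Proof.
pose moves (p : 'I_n * 'I_n) :=
  (p.1 < p.2) && (0 < #|A :\: compress p.1 p.2 A|).
case: (pickP moves) => [[i j] /andP[] /= | noij].
  by right; exists i, j.
left=> F i j FA lt_ij jF iF.
have := noij (i, j); rewrite /moves /= lt_ij /= => /negbT.
rewrite -leqNgt leqn0 cards_eq0 setD_eq0 => /subsetP/(_ F FA).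
have uF : upper i j F by rewrite /upper jF iF.
by rewrite inE uF -(swap_upper lt_ij uF) => /andP[].
Qed.

(** Induction on the weight, which drops whenever a compression moves a set. The inequality
    telescopes by [card_setD_triangle]; the factors 2 match the ordered pairs in [adj_pairs]. *)
Lemma exists_shifted s A : uniform s A ->
  exists H, [/\ shifted H, uniform s H, #|H| = #|A| &
    2 * #|A :\: H| + 2 * weight H + adj_pairs A <= 2 * weight A + adj_pairs H].
Proof.
have [m] := ubnP (weight A); elim: m => // m IHm in A * => ltAm sA.
case: (shifted_or_compressible A) => [shA | [i [j [lt_ij gt0]]]].
  by exists A; rewrite setDv cards0.
have wA := weight_compress lt_ij A; have eA := adj_pairs_compress lt_ij A.
have [] := IHm (compress i j A); [lia | exact: uniform_compress | ].
move=> H [shH sH cardH ineqH]; exists H; split=> //.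
  by rewrite cardH card_compress.
have := card_setD_triangle A (compress i j A) H; lia.
Qed.

(** [G] arises from [F] by replacing one element by a smaller one outside [F]. *)
Definition down F G :=
  [exists p : 'I_n * 'I_n,
    [&& p.1 < p.2, p.2 \in F, p.1 \notin F & G == p.1 |: (F :\ p.2)]].

Lemma adj_down F G : adj F G <= down F G + down G F.
Proof.
case adjFG: (adj F G) => //.
have /andP[/cards1P[x defx] /cards1P[y defy]] := adjFG.
have : x \in F :\: G by rewrite defx set11.
have : y \in G :\: F by rewrite defy set11.
rewrite !inE => /andP[yF yG] /andP[xG xF].
have exch (X Y : {set 'I_n}) a b :
  X :\: Y = [set a] -> Y :\: X = [set b] -> Y = b |: (X :\ a).
  move=> /setP XY /setP YX; apply/setP => v; have := XY v; have := YX v.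
  by rewrite !inE; case: (v \in X) (v \in Y) => [] [] //= <- <-.
have [lt_xy|lt_yx|eq_xy] := ltngtP x y.
- suff -> : down G F by rewrite addn1.
  by apply/existsP; exists (x, y); rewrite /= lt_xy yG xG (exch G F y x) ?eqxx.
- suff -> : down F G by [].
  by apply/existsP; exists (y, x); rewrite /= lt_yx xF yF (exch F G x y) ?eqxx.
- by move: yF; rewrite -(val_inj eq_xy) xF.
Qed.

Definition gaps F :=
  [set p : 'I_n * 'I_n | [&& p.1 < p.2, p.2 \in F & p.1 \notin F]].

Lemma card_down F : #|[set G | down F G]| <= #|gaps F|.
Proof.
apply: leq_trans (leq_imset_card (fun p : 'I_n * 'I_n => p.1 |: (F :\ p.2)) _).
apply/subset_leq_card/subsetP => G; rewrite inE.
case/existsP => p /and4P[p1 p2 p3 /eqP->].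
by apply: imset_f; rewrite inE p1 p2 p3.
Qed.

Lemma card_ord_lt (v : 'I_n) : \sum_(u : 'I_n) (u < v) = v.
Proof.
rewrite -(big_mkord xpredT (fun u => nat_of_bool (u < v))).
rewrite (big_cat_nat _ (ltnW (ltn_ord v))) //= [X in _ + X]big_nat_cond.
rewrite [X in _ + X]big1 ?addn0 => [|u /andP[/andP[vu _] _]]; last first.
  by rewrite ltnNge vu.
rewrite big_nat_cond (eq_bigr (fun=> 1)) => [|u /andP[/andP[_ ->]] //].
by rewrite -big_nat_cond sum_nat_const_nat subn0 muln1.
Qed.

(** The labels below an element of [F] lie either outside [F], giving gaps, or inside it, giving one
    pair for each two-element subset of [F]. Doubling avoids division. *)
Lemma card_gaps F : 2 * #|gaps F| + #|F| * #|F| = 2 * label_sum F + #|F|.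
Proof.
pose below F := \sum_(v in F) \sum_(u in F) (u < v).
have sumF : #|gaps F| + below F = label_sum F.
  have -> : #|gaps F| = \sum_u \sum_v ((u, v) \in gaps F).
    rewrite pair_big -sum1_card big_mkcond; apply: eq_bigr => -[u v] _ /=.
    by case: (_ \in _).
  rewrite exchange_big /= /below [X in _ + X]big_mkcond -big_split /=.
  rewrite /label_sum [RHS]big_mkcond; apply: eq_bigr => v _.
  case vF: (v \in F); last by rewrite big1 // => u _; rewrite inE /= vF andbF.
  rewrite [X in _ + X]big_mkcond -big_split -[RHS]card_ord_lt.
  apply: eq_bigr => u _.
  by rewrite inE /= vF; case: (u < v) (u \in F) => [] [].
have : 2 * below F + #|F| = #|F| * #|F|.
  have -> : #|F| * #|F| =
      \sum_(v in F) \sum_(u in F) ((u < v) + (v < u) + (u == v)).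
    rewrite -[LHS]sum_nat_const; apply: eq_bigr => v _; rewrite -sum1_card.
    by apply: eq_bigr => u _; rewrite -val_eqE /=; case: ltngtP.
  have -> : #|F| = \sum_(v in F) \sum_(u in F) (u == v).
    rewrite -sum1_card; apply: eq_bigr => v vF.
    by rewrite (bigD1 v vF) /= eqxx big1 // => u /andP[_ /negbTE->].
  rewrite mul2n -addnn {2}/below exchange_big -!big_split /=.
  by apply: eq_bigr => v _; rewrite -!big_split.
lia.
Qed.

(** Charge each edge of [H] to the endpoint from which a downward exchange yields the other; a set
    [F] is charged at most [#|gaps F|] times. *)
Lemma adj_pairs_le s H : uniform s H ->
  adj_pairs H + #|H| * (s * s) <= 2 * weight H + #|H| * s.
Proof.
move=> sH.
have leE : adj_pairs H <= 2 * \sum_(F in H) #|gaps F|.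
  apply: (@leq_trans (\sum_(F in H) \sum_(G in H) (down F G + down G F))).
    by apply: leq_sum => F _; apply: leq_sum => G _; apply: adj_down.
  rewrite (eq_bigr _ (fun F _ => big_split _ _ _ _ _)) big_split /=.
  rewrite [X in _ + X]exchange_big addnn -mul2n leq_mul2l /=.
  apply: leq_sum => F _; apply: leq_trans (card_down F).
  rewrite -sum1_card big_mkcond [X in _ <= X]big_mkcond.
  by apply: leq_sum => G _; rewrite inE; case: (G \in H) (down F G) => [] [].
apply: leq_trans (leq_add leE (leqnn _)) _.
rewrite /weight !big_distrr /= -!sum_nat_const -!big_split /=.
by apply: leq_sum => F FH; rewrite -(sH F FH) card_gaps.
Qed.

End Shifting.


(** * Trace of the squared up-Laplacian *)

Lemma sqr_signr (R : pzRingType) m : ((-1) ^+ m * (-1) ^+ m = 1 :> R).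
Proof. by rewrite -exprD addnn -signr_odd odd_double. Qed.

Section Trace.
Variables (R : rcfType) (n k : nat) (K : {set {set 'I_n}}).
Hypotheses (hK : simplicial_complex K) (hpure : pure k K).

Lemma facets_faces : facets K = faces K k.+1.
Proof.
apply/setP => F; rewrite !inE; apply/idP/andP => [maxF | [FK /eqP sF]].
  have [FK _] := maxsetP maxF; split=> //.
  by apply/eqP/hpure; rewrite inE.
have [G maxG sFG] := maxset_exists (P := [pred G | G \in K]) FK.
have sG : #|G| = k.+1 by apply: hpure; rewrite inE.
suff -> : F = G by [].
by apply/eqP; rewrite eqEcard sFG sF sG /=.
Qed.

(** Distinct sets can share a set obtained by deleting one vertex from each only if the deleted
    vertices are exactly the two that are exchanged. *)
Lemma setD1_eqE (F G : {set 'I_n}) v w : F != G -> v \in F -> w \in G ->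
  (F :\ v == G :\ w) = (F :\: G == [set v]) && (G :\: F == [set w]).
Proof.
move=> nFG vF wG; apply/eqP/andP => [/setP eqFG | [/eqP/setP FG /eqP/setP GF]].
  have vG : v \notin G.
    apply: contra nFG => vG; have := eqFG v; rewrite !inE eqxx vG andbT /=.
    move=> /esym/negbFE/eqP vw; subst w; apply/eqP/setP => x.
    by have := eqFG x; rewrite !inE; case: eqVneq => // ->; rewrite vF vG.
  have wF : w \notin F.
    have := eqFG w; rewrite !inE eqxx /=; case: eqVneq => [wv|_ /= ->//].
    by rewrite -wv wG in vG.
  split; apply/eqP/setP => x; have := eqFG x; rewrite !inE.
    case: (eqVneq x v) => [->|xv]; first by rewrite vF vG.
    case: (eqVneq x w) => [->|xw]; first by rewrite (negbTE wF) !andbF.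
    by move=> /= ->; case: (x \in G).
  case: (eqVneq x w) => [->|xw]; first by rewrite wF wG.
  case: (eqVneq x v) => [->|xv]; first by rewrite (negbTE vG) !andbF.
  by move=> /= ->; case: (x \in G).
apply/setP => x; have := FG x; have := GF x; rewrite !inE.
by case: (x \in F) (x \in G) => [] [] //= <- <-.
Qed.

(** The entries of $\partial_k^{\mathsf T}\partial_k$, indexed by sets instead of ordinals. *)
Definition gram (F G : {set 'I_n}) : R :=
  \sum_(T in faces K k) boundary_coef R F T * boundary_coef R G T.

Definition vsign (F : {set 'I_n}) (v : 'I_n) : R :=
  (-1) ^+ #|[set u in F | (u < v)%N]|.

Lemma gramE F G : F \in facets K ->
  gram F G =
    \sum_(v in F) \sum_(w in G | F :\ v == G :\ w) vsign F v * vsign G w.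
Proof.
rewrite facets_faces inE => /andP[FK /eqP sF].
rewrite /gram; under eq_bigr => T _ do rewrite /boundary_coef mulr_suml.
rewrite (exchange_big_dep (mem F)) /= => [|T v _ /andP[] //].
apply: eq_bigr => v vF; rewrite (big_pred1 (F :\ v)) => [|T].
  rewrite mulr_sumr; apply: eq_big => // w.
  by rewrite eq_sym.
rewrite vF /= inE andbC; apply/andP/eqP => [[/eqP-> //]|->].
rewrite (hK.2 F) ?subD1set //=; split=> //; apply/eqP.
by have := cardsD1 v F; rewrite vF sF add1n => -[->].
Qed.

(** A diagonal entry sums [k.+1] squared signs. Distinct adjacent facets share a single face of [k]
    vertices, giving a sign that squaring removes; other pairs share none. *)
Lemma gram_sqr F G : F \in facets K -> G \in facets K ->
  gram F G ^+ 2 = ((F == G) * (k.+1 * k.+1) + adj F G)%:R.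
Proof.
move=> FK GK; rewrite gramE //; have [<-|nFG] := eqVneq F G.
  rewrite adj_irrefl addn0 mul1n natrM -expr2; congr (_ ^+ 2).
  rewrite -(hpure FK) -sum1_card natr_sum; apply: eq_bigr => v vF.
  rewrite (big_pred1 v) => [|w]; first exact: sqr_signr.
  apply/andP/eqP => [[wF /eqP/setP/(_ w)]|-> //].
  by rewrite !inE eqxx wF andbT => /negbFE/eqP.
rewrite add0n.
transitivity ((\sum_(v in F)
  \sum_(w in G | (F :\: G == [set v]) && (G :\: F == [set w]))
    vsign F v * vsign G w) ^+ 2).
  congr (_ ^+ 2); apply: eq_bigr => v vF; apply: eq_bigl => w.
  by case wG: (w \in G) => //=; rewrite setD1_eqE.
case adjFG: (adj F G).
  have /andP[/cards1P[x defx] /cards1P[y defy]] := adjFG.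
  have : x \in F :\: G by rewrite defx set11.
  have : y \in G :\: F by rewrite defy set11.
  rewrite !inE => /andP[yF yG] /andP[xG xF].
  rewrite (bigD1 x) //= [X in _ + X]big1 ?addr0; last first.
    move=> v /andP[vF vx].
    rewrite big_pred0 // => w.
    by rewrite defx (inj_eq set1_inj) eq_sym (negbTE vx) andbF.
  rewrite (big_pred1 y) => [|w].
    by rewrite expr2 mulrACA !sqr_signr mulr1.
  rewrite defx defy eqxx (inj_eq set1_inj) eq_sym /=.
  by case: eqVneq => [->|]; rewrite ?yG ?andbF.
rewrite big1 ?expr0n // => v _; rewrite big_pred0 // => w.
apply: contraFF adjFG => /and3P[_ /eqP FG /eqP GF].
by rewrite /adj FG GF !cards1.
Qed.

Lemma trace_up_laplacian_sqr :
  \tr (up_laplacian R K k *m up_laplacian R K k) =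
  (#|facets K| * (k.+1 * k.+1) + adj_pairs (facets K))%:R.
Proof.
rewrite /up_laplacian; set B := boundary_mx R K k.
rewrite -mulmxA mxtrace_mulC -!mulmxA mulmxA.
have entry i j : (B^T *m B) i j = gram (enum_val i) (enum_val j).
  rewrite mxE /gram (big_enum_val (A := mem (faces K k))) /=.
  by apply: eq_bigr => l _; rewrite !mxE.
have gramC F G : gram F G = gram G F.
  by apply: eq_bigr => T _; rewrite mulrC.
(* By symmetry of the Gram matrix, the trace of its square is the sum of its squared entries. *)
transitivity (\sum_(F in facets K) \sum_(G in facets K) gram F G ^+ 2).
  rewrite facets_faces [RHS]big_enum_val /mxtrace /=; apply: eq_bigr => i _.
  rewrite mxE [RHS]big_enum_val; apply: eq_bigr => j _.
  by rewrite !entry [in X in _ * X]gramC expr2.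
rewrite natrD natrM -sum1_card natr_sum mulr_suml /adj_pairs natr_sum.
rewrite -big_split; apply: eq_bigr => F FK; rewrite natr_sum mul1r.
rewrite (eq_bigr _ (fun G => gram_sqr FK)).
under eq_bigr => G _ do rewrite natrD.
rewrite big_split /= (bigD1 F) //= eqxx mul1n big1 ?addr0 // => G /andP[_].
by rewrite eq_sym => /negbTE->.
Qed.

End Trace.

(** * Conjugate degrees and the final comparison *)

Lemma sum_indicator_leq m d :
  (d <= m)%N -> (\sum_(1 <= r < m.+1) (r <= d) = d)%N.
Proof.
elim: m => [|m IHm] in d *; first by rewrite leqn0 => /eqP->; rewrite big_geq.
rewrite leq_eqVlt ltnS big_nat_recr //= => /orP[/eqP->|le_dm].
  rewrite leqnn (@eq_big_nat _ _ _ _ _ _ (fun=> 1%N)) => [|r /andP[_ lt_rm]].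
    by rewrite sum_nat_const_nat subn1 muln1 addn1.
  by rewrite ltnW.
by rewrite IHm // leqNgt ltnS le_dm addn0.
Qed.

(** Summing over [r] the pairs of vertices both of degree at least [r] gives the sum of pairwise
    minima. By the ordering each minimum is the degree of the larger label, so [v] accounts for
    [2 * v + 1] ordered pairs; then count incidences by facets. *)
Lemma sum_sqr_conj_vdeg n (K : {set {set 'I_n}}) :
  (forall i j : 'I_n, (i <= j)%N -> (vdeg K j <= vdeg K i)%N) ->
  (\sum_(1 <= r < #|facets K|.+1) conj_vdeg K r * conj_vdeg K r =
   \sum_(F in facets K) (2 * label_sum F + #|F|))%N.
Proof.
move=> hdeg.
have degE r : conj_vdeg K r = (\sum_v (r <= vdeg K v))%N.
  rewrite /conj_vdeg -sum1_card big_mkcond; apply: eq_bigr => v _.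
  by rewrite inE; case: (_ <= _)%N.
have vdeg_le v : (vdeg K v <= #|facets K|)%N.
  by apply/subset_leq_card/subsetP => F; rewrite !inE => /andP[].
transitivity (\sum_v \sum_w minn (vdeg K v) (vdeg K w))%N.
  under eq_bigr => r _ do rewrite !degE big_distrlr.
  rewrite exchange_big; apply: eq_bigr => v _ /=.
  rewrite exchange_big; apply: eq_bigr => w _ /=.
  rewrite -[RHS](@sum_indicator_leq #|facets K|) ?geq_min ?vdeg_le //.
  by apply: eq_bigr => r _; rewrite leq_min; do 2!case: (_ <= _)%N.
transitivity (\sum_(v : 'I_n) vdeg K v * (2 * v + 1))%N.
  transitivity (\sum_(v : 'I_n) \sum_(w : 'I_n) ((w < v) * vdeg K v
      + (v < w) * vdeg K w + (w == v) * vdeg K v))%N.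
    apply: eq_bigr => v _; apply: eq_bigr => w _; rewrite -val_eqE /=.
    case: ltngtP => [lt|lt|eq] /=.
    - by have := hdeg w v (ltnW lt); lia.
    - by have := hdeg v w (ltnW lt); lia.
    - by rewrite (val_inj eq); lia.
  under eq_bigr => v _ do rewrite !big_split.
  rewrite !big_split /= [X in (_ + X + _)%N]exchange_big -!big_split /=.
  apply: eq_bigr => v _; rewrite -!big_distrl /= card_ord_lt.
  rewrite (bigD1 v) //= eqxx big1 => [|w /negbTE-> //]; lia.
transitivity (\sum_(v : 'I_n) \sum_(F in facets K | v \in F) (2 * v + 1))%N.
  apply: eq_bigr => v _; rewrite /vdeg -sum1_card big_distrl /=.
  by apply: eq_big => [F|F _]; rewrite ?inE // mul1n.
rewrite (exchange_big_dep (mem (facets K))) /= => [|v F _ /andP[] //].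
apply: eq_bigr => F FK.
rewrite (eq_bigl (mem F)) => [|v]; last by rewrite FK.
by rewrite big_split -big_distrr /= sum1_card.
Qed.

Lemma card_symdiff (T : finType) (A B : {set T}) :
  #|A| = #|B| -> #|symdiff A B| = (2 * #|A :\: B|)%N.
Proof.
move=> eqAB; rewrite /symdiff cardsU.
have -> : (A :\: B) :&: (B :\: A) = set0.
  by apply/setP => x; rewrite !inE; case: (x \in A) (x \in B) => [] [].
have := cardsID B A; have := cardsID A B; rewrite (setIC B) cards0; lia.
Qed.

(* Since vdeg K v <= #|facets K|, the terms of the sum over r >= 1 vanish for
   r > #|facets K|. *)
Theorem theorem1p2 (R : rcfType) (n k : nat) (K : {set {set 'I_n}})
  (hk : (1 <= k)%N)
  (hK : simplicial_complex K)
  (hpure : pure k K)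
  (hdeg : forall i j : 'I_n, (i <= j)%N -> (vdeg K j <= vdeg K i)%N) :
  exists H : {set {set 'I_n}},
    [/\ shifted H,
        uniform k.+1 H,
        #|H| = #|facets K| &
        (#|symdiff (facets K) H|%:R / 2 : R) <=
          (\sum_(1 <= r < #|facets K|.+1) (conj_vdeg K r)%:R ^+ 2
           - \sum_(l <- nz_eigenvalues (up_laplacian R K k)) l ^+ 2) / 2].
Proof.
have [H [shH sH cardH ineqH]] := exists_shifted hpure.
exists H; split=> //; rewrite ler_pM2r ?invr_gt0 ?ltr0n //.
rewrite sum_sqr_nz_eigenvalues; last by rewrite trmx_mul trmxK.
rewrite trace_up_laplacian_sqr // lerBrDr.
under eq_bigr => r _ do rewrite expr2 -natrM.
rewrite -natr_sum -natrD ler_nat sum_sqr_conj_vdeg // card_symdiff //.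
rewrite big_split -big_distrr -/(weight _) /=.
rewrite [X in (_ <= _ + X)%N](eq_bigr (fun=> k.+1)) => [|F /hpure //].
rewrite sum_nat_const; have := adj_pairs_le sH; rewrite cardH.
(* Adding the two bounds cancels [2 * weight H] and [adj_pairs H]; products are abstracted to keep
   the problem linear. *)
have arith (a b c d e p q : nat) :
  (a + b + c <= d + e -> e + p <= b + q -> a + (p + c) <= d + q)%N by lia.
exact: arith ineqH.
Qed.
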